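(* Let $G$ be a finite connected graph with vertex set $V$ and edge set $E$, and assume that $G$ is not a tree. Let $K$ be a non-empty subset of $V$, let $q$ be a positive integer with $q\leq |K|$, and let $n$ be a natural number with $n\geq q$. Put $k:=|K|$ and $\varepsilon:=|E|-|V|$. Then the Euler characteristic of the generalized anchored configuration space $\Sigma(G,K,n,q)$ satisfies \[ \frac{(-1)^{n-q}}{q!}\,\chi(\Sigma(G,K,n,q))= \sum_{\lambda=\varepsilon}^{\varepsilon+k-q}\ \sum_{t=0}^{n-q}\binom{\lambda-\varepsilon+q-1}{q-1} \binom{n}{t}\genfrac{\{}{\}}{0pt}{}{n-t}{q}\lambda^t, \] where the convention $0^0=1$ (and $0^t=0$ for $t>0$) is used.
   Context: Graphs are identified with their geometric realizations, i.e. $1$-dimensional CW complexes with $0$-cells $V$ and $1$-cells $E$ (parallel edges are allowed). For a topological space $X$, a set $K$ of $k\ge 0$ distinct points of $X$, a positive integer $n$, and an integer $q$ with $0\leq q\leq k$, the generalized anchored configuration space $\Sigma(X,K,n,q)$ is the subspace of $X^n$ consisting of all tuples $(x_1,\dots,x_n)$ such that $|K\cap\{x_1,\dots,x_n\}|\geq q$. For a graph $G$ and $K\subseteq V$, $\Sigma(G,K,n,q)$ denotes this space for $X$ the geometric realization of $G$; it is a subcomplex of the product cell complex $G^n$, whose (open) cells are products $\sigma_1\times\dots\times\sigma_n$ with $\sigma_i\in V\cup E$, and it consists of those cells for which at least $q$ elements of $K$ occur among $\sigma_1,\dots,\sigma_n$. $\chi$ denotes the Euler characteristic. For integers $a\ge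 b\ge 1$, $\genfrac{\{}{\}}{0pt}{}{a}{b}$ is the Stirling number of the second kind: the number of partitions of a set of $a$ labelled objects into $b$ non-empty unlabelled subsets. *)

(* Defs.v *)
From HB Require Import structures.
From mathcomp Require Import all_boot all_order all_algebra finmap.
From mathcomp Require Import all_classical all_reals all_analysis.

Set Implicit Arguments.
Unset Strict Implicit.
Unset Printing Implicit Defensive.

Import Order.TTheory GRing.Theory Num.Theory.
Import numFieldNormedType.Exports.

Local Open Scope classical_set_scope.
Local Open Scope ring_scope.

(* Parallel edges and loops are allowed. The order of the two endpoints only
   fixes a parametrization of the edge. *)
Record multigraph := Multigraph {
  vertex : finType;
  edge : finType;
  src : edge -> vertex;
  tgt : edge -> vertex }.

Definition joins (G : multigraph) (e : edge G) (u v : vertex G) : bool :=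
  ((src e == u) && (tgt e == v)) || ((src e == v) && (tgt e == u)).

Definition adjacent (G : multigraph) : rel (vertex G) :=
  fun u v => [exists e : edge G, joins e u v].

Definition connected_graph (G : multigraph) : Prop :=
  (0 < #|vertex G|)%N /\ forall u v : vertex G, connect (@adjacent G) u v.

(* [ordS i] is the cyclic successor, so the edge [e i] joins [v i] to [v (i+1)]
   modulo the length. A loop is a cycle of length 1, and two parallel edges form
   a cycle of length 2. *)
Definition has_cycle (G : multigraph) : Prop :=
  exists (m : nat) (v : 'I_m.+1 -> vertex G) (e : 'I_m.+1 -> edge G),
    [/\ injective v, injective e & forall i, joins (e i) (v i) (v (ordS i))].

Definition is_tree (G : multigraph) : Prop :=
  connected_graph G /\ ~ has_cycle G.

(* The points of the quotient of the disjoint union of the vertices and of one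
   copy of [0, 1] per edge that glues the endpoints of each edge: every class
   contains either exactly one vertex or exactly one interior point. *)
Definition realization (R : realType) (G : multigraph) : Type :=
  (vertex G + edge G * {t : R | 0 < t < 1})%type.

HB.instance Definition _ (R : realType) (G : multigraph) :=
  Choice.copy (realization R G)
    (vertex G + edge G * {t : R | 0 < t < 1})%type.

Definition vertex_pt (R : realType) (G : multigraph) (v : vertex G) :
  realization R G := inl v.

Definition edge_pt (R : realType) (G : multigraph) (e : edge G)
  (t : {t : R | 0 < t < 1}) : realization R G := inr (e, t).

(* The characteristic map [0, 1] -> G of the edge [e], precomposed with the
   retraction of the real line onto [0, 1]. *)
Definition char_map (R : realType) (G : multigraph) (e : edge G) (t : R) :
    realization R G :=
  if insub t is Some s then edge_pt e s
  else if t <= 0 then vertex_pt R (src e) else vertex_pt R (tgt e).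

(* The quotient (weak) topology. Because of the retraction, the preimage is open
   in the real line iff its trace on [0, 1] is open in [0, 1]. *)
Definition realization_open (R : realType) (G : multigraph)
    (U : set (realization R G)) : Prop :=
  forall e : edge G, open (char_map e @^-1` U : set R).

Section RealizationTopology.
Variables (R : realType) (G : multigraph).

Fact realization_openT : @realization_open R G setT.
Proof. by move=> e; rewrite preimage_setT; exact: openT. Qed.

Fact realization_openI : setI_closed (@realization_open R G).
Proof.
by move=> A B oA oB e; rewrite preimage_setI; apply: openI; [exact: oA|exact: oB].
Qed.

Fact realization_open_bigU (I : Type) (f : I -> set (realization R G)) :
  (forall i, realization_open (f i)) -> realization_open (\bigcup_i f i).
Proof.
by move=> of_ e; rewrite preimage_bigcup; apply: bigcup_open => i _; exact: of_.
Qed.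

HB.instance Definition _ := isOpenTopological.Build (realization R G)
  realization_openT realization_openI realization_open_bigU.

Lemma realization_openE : @open (realization R G) = @realization_open R G.
Proof. by []. Qed.

End RealizationTopology.

Definition power (X : topologicalType) (n : nat) : topologicalType :=
  prod_topology (fun _ : 'I_n => X).

(* [Sigma K n q] is the generalized anchored configuration space: the tuples
   whose set of entries meets [K] in at least [q] points. *)
Definition Sigma (X : topologicalType) (K : set X) (n q : nat) :
    set (power X n) :=
  [set x : power X n | (`I_q #<= K `&` range x)%card].

(* A cell of [G^n] is a product of [n] vertices and edges of [G]. *)
Definition cell (G : multigraph) (n : nat) : finType :=
  {ffun 'I_n -> vertex G + edge G}.

Definition cell_dim (G : multigraph) (n : nat) (c : cell G n) : nat :=
  #|[set i | if c i is inr _ then true else false]%SET|.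

Definition factor (R : realType) (G : multigraph) (s : vertex G + edge G) :
    set (realization R G) :=
  match s with
  | inl v => [set vertex_pt R v]
  | inr e => range (@edge_pt R G e)
  end.
Arguments factor R {G} s _.

Definition open_cell (R : realType) (G : multigraph) (n : nat) (c : cell G n) :
    set (power (realization R G) n) :=
  [set x : power (realization R G) n | forall i, factor R (c i) (x i)].
Arguments open_cell R {G n} c _.

Definition cells_of (R : realType) (G : multigraph) (n : nat)
    (A : set (power (realization R G) n)) : {set cell G n} :=
  [set c : cell G n | `[< open_cell R c `<=` A >]]%SET.

Definition subcomplex (R : realType) (G : multigraph) (n : nat)
    (A : set (power (realization R G) n)) : Prop :=
  closed A /\ A = \bigcup_(c in [set` cells_of A]) open_cell R c.

(* The Euler characteristic of a finite CW complex as the alternating sum of its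
   numbers of cells; meaningful when [A] is a subcomplex of [G^n]. The instance
   used is justified by [subcomplex_Sigma] below. *)
Definition euler_char (R : realType) (G : multigraph) (n : nat)
    (A : set (power (realization R G) n)) : int :=
  \sum_(0 <= d < n.+1)
    (-1) ^+ d * #|[set c in cells_of A | cell_dim c == d]%SET|%:Z.

Definition vertex_pts (R : realType) (G : multigraph) (K : {set vertex G}) :
    set (realization R G) :=
  @vertex_pt R G @` [set` K].
Arguments vertex_pts R {G} K _.

Definition stirling2 (a b : nat) : nat :=
  #|[set P : {set {set 'I_a}} |
      finset.partition P [set: 'I_a] & #|P| == b]%SET|.

(* The integers [a], [a + 1], ..., [b], and no integer if [b < a]. *)
Definition int_range (a b : int) : seq int :=
  if a <= b then [seq a + i%:Z | i <- iota 0 `|b - a|.+1] else [::].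

Section Subcomplex.
Variables (R : realType) (G : multigraph) (K : {set vertex G}) (n q : nat).

Let half : {t : R | 0 < t < 1}.
Proof. by exists 2^-1; rewrite invr_gt0 ltr0n /= invf_lt1 ?ltr0n // ltr1n. Qed.

Let cell_of_pt (x : power (realization R G) n) : cell G n :=
  [ffun i => match x i with inl v => inl v | inr (e, _) => inr e end].

Let open_cell_of_pt x : open_cell R (cell_of_pt x) x.
Proof.
by move=> i; rewrite ffunE; case: (x i) => [v|[e t]] //=; exists t.
Qed.

Let open_cell_neq0 (c : cell G n) : open_cell R c !=set0.
Proof.
exists (fun i => match c i with
  | inl v => vertex_pt R v | inr e => edge_pt e half end).
by move=> i /=; case: (c i) => //= e; exists half.
Qed.

Let range_open_cell (c : cell G n) x : open_cell R c x ->
  vertex_pts R K `&` range x =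
  vertex_pts R [set v in K | inl v \in codom c]%SET.
Proof.
move=> cx; apply/seteqP; split=> y /=.
  move=> [[v /= vK <-] [i _ xi]]; exists v => //=.
  rewrite inE vK /=; apply/codomP; exists i.
  by move: (cx i); rewrite xi; case: (c i) => [w /= [->]//|e /= [t _]].
move=> [v /=]; rewrite inE => /andP[vK /codomP[i ci]] <-; split; first by exists v.
by exists i => //; move: (cx i); rewrite -ci.
Qed.

Let card_vertex_pts (A : {set vertex G}) :
  (`I_q #<= vertex_pts R A)%card = (q <= #|A|)%N.
Proof.
have cA : ([set` A] #= `I_#|A|)%card.
  have -> : [set` A] = [set` seq_fset tt (enum A)].
    by apply/funext => v; rewrite /mkset seq_fsetE mem_enum.
  by apply/card_eq_fsetP; rewrite size_seq_fset undup_id ?enum_uniq // -cardE.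
have iA : (vertex_pts R A #= [set` A])%card.
  by apply: inj_card_eq => u v _ _ [].
by rewrite (card_le_eqr iA) (card_le_eqr cA) card_le_II.
Qed.

Lemma open_cell_Sigma (c : cell G n) :
  open_cell R c `<=` Sigma (vertex_pts R K) q <->
  (q <= #|[set v in K | inl v \in codom c]%SET|)%N.
Proof.
split=> [cS|cq x cx].
  have [x cx] := open_cell_neq0 c.
  by rewrite -card_vertex_pts -(range_open_cell cx); exact: cS.
by rewrite /Sigma /= (range_open_cell cx) card_vertex_pts.
Qed.

Let closed_vertex_pt (v : vertex G) : closed [set vertex_pt R v].
Proof.
rewrite -[X in closed X]setCK; apply: open_closedC.
rewrite realization_openE => e.
rewrite -preimage_setC; apply: closed_openC.
have -> : char_map e @^-1` [set vertex_pt R v] =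
  (if src e == v then [set t : R | t <= 0] else set0) `|`
  (if tgt e == v then [set t : R | 1 <= t] else set0).
  apply/seteqP; split=> t; rewrite /= /char_map.
    case: insubP => [//|/=]; rewrite negb_and -!leNgt.
    move=> t01; case: ifP => t0 [<-]; first by left; rewrite eqxx.
    by right; rewrite eqxx /=; move: t01; rewrite t0.
  case: insubP => [s /andP[s0 s1] _ [|]|_ [|]]; case: ifP => //= /eqP <-.
  - by rewrite leNgt s0.
  - by rewrite leNgt s1.
  - by move=> ->.
  - by case: ifP => // t0 t1; move: (le_trans t1 t0); rewrite ler10.
by apply: closedU; case: ifP => _; [exact: closed_le|exact: closed0|
  exact: closed_ge|exact: closed0].
Qed.

Lemma subcomplex_Sigma : subcomplex (Sigma (vertex_pts R K) q
  : set (power (realization R G) n)).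
Proof.
split.
  have -> : (Sigma (vertex_pts R K) q : set (power (realization R G) n)) =
    \bigcup_(A in [set A : {set vertex G} | A \subset K /\ (q <= #|A|)%N])
    \bigcap_(v in [set` A]) \bigcup_(i in [set: 'I_n])
      (@proj _ (fun=> realization R G) i @^-1` [set vertex_pt R v]).
    apply/seteqP; split=> x.
      rewrite /Sigma /= (range_open_cell (open_cell_of_pt x)) card_vertex_pts => qA.
      exists [set v in K | inl v \in codom (cell_of_pt x)]%SET.
        by split=> //; apply/fintype.subsetP => v; rewrite inE => /andP[].
      move=> v /=; rewrite inE => /andP[_ /codomP[i ci]]; exists i => //=.
      by move: (open_cell_of_pt x i); rewrite -ci.
    move=> [A /= [/fintype.subsetP AK qA] Ax]; rewrite /Sigma /=.
    move: qA; rewrite -card_vertex_pts => /card_le_trans; apply.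
    apply: subset_card_le => _ [v vA <-]; split; first by exists v => //; exact: AK.
    by have [i _ xi] := Ax v vA; exists i.
  apply: closed_bigcup; first exact: finite_finset.
  move=> A _; apply: closed_bigI => v _; apply: closed_bigcup.
    exact: finite_finset.
  move=> i _; apply: preimage_closed; last exact: closed_vertex_pt.
  by move=> x _; exact: proj_continuous.
apply/seteqP; split=> x.
  move=> Sx; exists (cell_of_pt x) => //=; rewrite inE; apply/asboolP.
  apply/open_cell_Sigma; move: Sx; rewrite /Sigma /=.
  by rewrite (range_open_cell (open_cell_of_pt x)) card_vertex_pts.
by move=> [c /=]; rewrite inE => /asboolP; exact.
Qed.

End Subcomplex.

(* Main.v *)
Require Import Defs.
From mathcomp Require Import all_boot all_order all_algebra finmap.
From mathcomp Require Import all_classical all_reals all_analysis.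
From mathcomp Require Import ring zify.
Set Implicit Arguments.
Unset Strict Implicit.
Unset Printing Implicit Defensive.
Import Order.TTheory GRing.Theory Num.Theory.
Local Open Scope ring_scope.

(** Let [D] be the forward difference operator and [f x = x ^ n]. A cell of
    [G^n] counts with sign the product of [1] per vertex and [-1] per edge, so the
    cells whose [K]-entries lie in [B] have total [(#|B| - k - eps) ^ n], and
    those with set of [K]-entries exactly [A] have total [D^a f (- k - eps)],
    [a = #|A|]. Hence the Euler characteristic is
    [sum_(a >= q) C(k, a) D^a f (- k - eps)]. Since [1 + D] is the unit shift,
    this truncated binomial expansion is a combination of translates of [D^q f],
    which the parity of [f] reflects to the points [eps + i]. Finally
    [D^q (y ^ m) (0) = q! S(m, q)], because both sides count surjections, and the
    binomial theorem expands [D^q f (eps + i)]. *)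

(** * Finite differences and truncated Newton expansions *)

Definition fdiff (f : int -> int) (x : int) : int := f (x + 1) - f x.

Lemma iter_fdiffS (a : nat) (f : int -> int) (x : int) :
  iter a.+1 fdiff f x = iter a fdiff f (x + 1) - iter a fdiff f x.
Proof. by []. Qed.

Lemma iter_fdiff_shift (a : nat) (f : int -> int) (x y : int) :
  iter a fdiff f (x + y) = iter a fdiff (fun z => f (x + z)) y.
Proof. by elim: a y => // a IHa y; rewrite !iter_fdiffS -!IHa addrA. Qed.

Lemma iter_fdiff_sum (I : Type) (r : seq I) (c : I -> int)
    (g : I -> int -> int) (a : nat) (x : int) :
  iter a fdiff (fun y => \sum_(i <- r) c i * g i y) x =
  \sum_(i <- r) c i * iter a fdiff (g i) x.
Proof.
elim: a x => // a IHa x.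
rewrite iter_fdiffS !IHa -sumrB; apply: eq_bigr => i _.
by rewrite -mulrBr.
Qed.

(** Negation carries the nodes [x, ..., x + a] to [- x - a, ..., - x]; each difference reverses
    orientation and gives a factor [-1], while [s] is the parity of [f]. *)
Lemma iter_fdiff_reflect (f : int -> int) (s : int) (a : nat) (x : int) :
  (forall y, f (- y) = s * f y) ->
  iter a fdiff f (- x - a%:Z) = (-1) ^+ a * s * iter a fdiff f x.
Proof.
move=> fN; elim: a x => [|a IHa] x; first by rewrite subr0 /= fN mul1r.
rewrite !iter_fdiffS.
have -> : - x - a.+1%:Z + 1 = - x - a%:Z by lia.
have -> : - x - a.+1%:Z = - (x + 1) - a%:Z by lia.
rewrite !IHa exprS; ring.
Qed.

(* The polynomial identity
   sum_(a > q) C(k+1,a) D^a = D^(q+1) sum_i C(i+q,q) (1+D)^(k-q-i)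
   at the difference operator; [k] and [q] are shifted by one from the theorem. *)
Lemma truncated_newton (f : int -> int) (q k : nat) (x : int) : (q <= k)%N ->
  \sum_(q.+1 <= a < k.+2) 'C(k.+1, a)%:Z * iter a fdiff f x =
  \sum_(0 <= i < (k - q).+1)
    'C(i + q, q)%:Z * iter q.+1 fdiff f (x + (k - q)%:Z - i%:Z).
Proof.
pose T k x := \sum_(q.+1 <= a < k.+1) 'C(k, a)%:Z * iter a fdiff f x.
have TS j y : (q <= j)%N ->
    T j.+1 y = T j (y + 1) + 'C(j, q)%:Z * iter q.+1 fdiff f y.
  move=> qj; rewrite /T.
  (* The unit shift is [1 + D], so each term splits into one in [D^a] and one in [D^(a+1)];
     reindexing and Pascal's rule recombine them. *)
  under [in RHS]eq_bigr => a _.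
    rewrite -[iter a _ _ _](subrK (iter a fdiff f y)) -iter_fdiffS addrC mulrDr.
    over.
  rewrite big_split /= -addrA.
  have -> : \sum_(q.+1 <= a < j.+1) 'C(j, a)%:Z * iter a.+1 fdiff f y
      + 'C(j, q)%:Z * iter q.+1 fdiff f y =
      \sum_(q.+1 <= a < j.+2) 'C(j, a.-1)%:Z * iter a fdiff f y.
    by rewrite [RHS]big_add1 /= [RHS]big_ltn // addrC.
  have -> : \sum_(q.+1 <= a < j.+1) 'C(j, a)%:Z * iter a fdiff f y =
      \sum_(q.+1 <= a < j.+2) 'C(j, a)%:Z * iter a fdiff f y.
    by rewrite [RHS]big_nat_recr //= bin_small ?mul0r ?addr0.
  rewrite -big_split /= !big_add1 /=; apply: eq_bigr => a _.
  by rewrite binS PoszD mulrDl.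
(* Induction on [m = k - q] with [q] fixed: [TS] moves the base point by one and produces the new
   last summand. *)
suff Tm m y : T (m + q).+1 y = \sum_(0 <= i < m.+1)
    'C(i + q, q)%:Z * iter q.+1 fdiff f (y + m%:Z - i%:Z).
  by move=> qk; rewrite -Tm subnK.
elim: m y => [|m IHm] y.
  by rewrite TS // {1}/T big_geq // big_nat1 add0r binn addr0 subr0.
rewrite TS; last exact: leq_addl.
rewrite IHm [RHS]big_nat_recr //=; congr (_ + _); last first.
  by rewrite addrK.
apply: eq_bigr => i _; congr (_ * iter q.+1 fdiff f _).
by lia.
Qed.

(** For [k > 0] the terms with [a >= 1] are the case [q = 0] of [truncated_newton], which telescopes
    to [f (x + k) - f x]; the term [a = 0] supplies [f x]. *)
Lemma newton (f : int -> int) (k : nat) (x : int) :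
  \sum_(0 <= a < k.+1) 'C(k, a)%:Z * iter a fdiff f x = f (x + k%:Z).
Proof.
case: k => [|k]; first by rewrite big_nat1 bin0 mul1r addr0.
rewrite big_ltn // bin0 mul1r truncated_newton // subn0.
under eq_bigr => i _.
  have -> : 'C(i + 0, 0)%:Z * iter 1 fdiff f (x + k%:Z - i%:Z) =
      - f (x + k.+1%:Z - i.+1%:Z) - - f (x + k.+1%:Z - i%:Z).
    rewrite bin0 mul1r iter_fdiffS /= addrC opprK; congr (- f _ + f _); lia.
  over.
rewrite (telescope_sumr (fun i : nat => - f (x + k.+1%:Z - i%:Z))) // opprK addrK subr0.
by rewrite addNKr.
Qed.

(** * Subset sums and weighted counts of maps by their anchors *)

Lemma sum_subsets_card (T : finType) (K : {set T}) (P : pred nat)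
    (g : nat -> int) :
  \sum_(A : {set T} | (A \subset K) && P #|A|) g #|A| =
  \sum_(0 <= a < #|K|.+1 | P a) 'C(#|K|, a)%:Z * g a.
Proof.
(* Subsets of [K] have at most [#|K|] elements, so [inord] never takes its default value. *)
rewrite big_mkord (partition_big (fun A : {set T} => inord #|A| : 'I_#|K|.+1)
  (fun a => P a)) /= => [|A /andP[AK PA]]; last first.
  by rewrite inordK // ltnS subset_leq_card.
apply: eq_bigr => a Pa; rewrite -natz mulr_natl -cards_draws -sumr_const.
apply: eq_big => [A|A /andP[/andP[AK _] /eqP <-]]; last first.
  by rewrite inordK // ltnS subset_leq_card.
rewrite inE -andbA; case: (boolP (A \subset K)) => //= AK.
have aE : (inord #|A| == a) = (#|A| == a).
  by rewrite -val_eqE /= inordK // ltnS subset_leq_card.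
by rewrite aE; case: eqP => [->|]; rewrite ?Pa ?andbF.
Qed.

(* By Newton's formula [B |-> D^#|B| f x] has these subset sums, and subset sums
   determine a set function. *)
Lemma subset_sum_fdiff (T : finType) (K : {set T}) (H : {set T} -> int)
    (f : int -> int) (x : int) :
  (forall B : {set T}, B \subset K ->
    \sum_(A : {set T} | A \subset B) H A = f (x + #|B|%:Z)) ->
  forall B : {set T}, B \subset K -> H B = iter #|B| fdiff f x.
Proof.
move=> Hf B; have [m] := ubnP #|B|; elim: m B => // m IHm B Bm BK.
have /= := sum_subsets_card B xpredT (fun a => iter a fdiff f x).
under eq_bigl do rewrite andbT.
(* Both expansions of [f (x + #|B|)] agree on proper subsets of [B] by induction, hence also at
   [B]. *)
rewrite newton -(Hf _ BK) (bigD1 B) // [RHS](bigD1 B) //=.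
rewrite [X in _ + X = _](eq_bigr H); first by move=> /addIr.
move=> A; rewrite andbC -finset.properEneq => AB; apply/esym/IHm.
  by rewrite (leq_trans (proper_card AB)).
by rewrite (fintype.subset_trans (proper_sub AB)).
Qed.

(** Kept general for two uses: cells of [G^n] with [K] a set of vertices, and surjections, which are
    the maps with full anchor set when [K] is all of [S]. *)
Definition anchors (I S : finType) (K : {set S}) (f : {ffun I -> S}) : {set S} :=
  [set s in K | s \in codom f]%SET.

Section AnchoredCount.
Variables (I S : finType) (K : {set S}) (w : S -> int).
Hypothesis wK : forall s, s \in K -> w s = 1.

(** If only containment of the anchors in [B] is required, each entry ranges independently over [B]
    and the complement of [K]. The sum is then a power of [#|B|] plus the weight outside [K], and
    [subset_sum_fdiff] applies. *)
Lemma sum_anchors_eq (B : {set S}) : B \subset K ->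
  \sum_(f : {ffun I -> S} | anchors K f == B) \prod_i w (f i) =
  iter #|B| fdiff (fun x => x ^+ #|I|) (\sum_(s | s \notin K) w s).
Proof.
move: B; apply: subset_sum_fdiff => B BK.
transitivity (\sum_(f : {ffun I -> S} | anchors K f \subset B) \prod_i w (f i)).
  rewrite [RHS](partition_big (anchors K) (fun A => A \subset B)) //=.
  apply: eq_bigr => A AB; apply: eq_bigl => f.
  by case: eqP => [->|]; rewrite ?AB ?andbF.
transitivity (\prod_(i : I) \sum_(s | (s \notin K) || (s \in B)) w s); last first.
  rewrite prodr_const; congr (_ ^+ _).
  rewrite (bigID (mem K)) /= addrC; congr (_ + _).
    by apply: eq_bigl => s; case: (s \in K); rewrite ?andbF ?andbT.
  rewrite (eq_bigr (fun=> 1)) => [|s /andP[_ /wK] //].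
  rewrite sumr_const -[RHS]intz -pmulrn; congr (_ *+ _).
  apply: eq_card => s; rewrite unfold_in /=.
  by have /implyP := fintype.subsetP BK s; case: (s \in B); case: (s \in K).
rewrite bigA_distr_big; apply: eq_bigl => f.
apply/fintype.subsetP/ffun_onP => [fB i|fB s].
  rewrite unfold_in; have := fB (f i); rewrite inE codom_f andbT.
  by case: (f i \in K) => //; apply.
by rewrite inE => /andP[sK /codomP[i sE]]; have := fB i; rewrite unfold_in -sE sK.
Qed.

Lemma sum_anchors_geq (q : nat) :
  \sum_(f : {ffun I -> S} | (q <= #|anchors K f|)%N) \prod_i w (f i) =
  \sum_(q <= a < #|K|.+1) 'C(#|K|, a)%:Z *
    iter a fdiff (fun x => x ^+ #|I|) (\sum_(s | s \notin K) w s).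
Proof.
rewrite (partition_big (anchors K)
  (fun A => (A \subset K) && (q <= #|A|)%N)) /= => [|f ->]; last first.
  by rewrite andbT; apply/fintype.subsetP => s; rewrite inE => /andP[].
rewrite (big_nat_widenl _ 0%N) // -sum_subsets_card.
apply: eq_bigr => A /andP[AK qA]; rewrite -sum_anchors_eq //.
by apply: eq_bigl => f; case: eqP => [->|]; rewrite ?qA ?andbF.
Qed.
End AnchoredCount.

(** * Surjections, set partitions and Stirling numbers *)

Definition fibers (I S : finType) (f : {ffun I -> S}) : {ffun S -> {set I}} :=
  [ffun s => f @^-1: [set s]]%SET.

Lemma mem_fibers (I S : finType) (f : {ffun I -> S}) (s : S) (i : I) :
  (i \in fibers f s) = (f i == s).
Proof. by rewrite ffunE !inE. Qed.

Lemma fibers_inj (I S : finType) : injective (@fibers I S).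
Proof.
move=> f g fg; apply/ffunP => i; apply/eqP.
by rewrite -mem_fibers fg mem_fibers.
Qed.

(** Surjectivity makes the disjoint fibres non-empty, hence distinct. Conversely, in an injectively
    labelled partition, sending a point to the label of its block defines a surjection. *)
Lemma onto_fibers (I S : finType) (g : {ffun S -> {set I}}) :
  (g \in @fibers I S @: [set f | anchors finset.setT f == finset.setT])%SET =
  injectiveb g && finset.partition (g @: finset.setT)%SET finset.setT.
Proof.
apply/imsetP/andP.
  move=> [f]; rewrite inE => /eqP fT ->.
  have fonto s : exists i, f i = s.
    have : s \in anchors finset.setT f by rewrite fT inE.
    by rewrite !inE /= => /codomP[i ->]; exists i.
  split.
    apply/injectiveP => s t st; have [i fi] := fonto s.
    by apply/eqP; rewrite -fi -mem_fibers -st mem_fibers fi.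
  apply/and3P; split.
  - apply/eqP/setP => i; rewrite inE; apply/bigcupP.
    by exists (fibers f (f i)); rewrite ?imset_f ?mem_fibers.
  - apply/finset.trivIsetP => _ _ /imsetP[s _ ->] /imsetP[t _ ->] st.
    apply/pred0P => i /=; rewrite !mem_fibers; apply/andP => -[/eqP fs /eqP ft].
    by move: st; rewrite -fs -ft eqxx.
  - apply/imsetP => -[s _ s0]; have [i fi] := fonto s.
    by have := mem_fibers f s i; rewrite -s0 inE fi eqxx.
move=> [/injectiveP ginj /and3P[/eqP gT /finset.trivIsetP gtriv g0]].
have gex i : {s | i \in g s}.
  apply/sigW; have : i \in finset.cover (g @: finset.setT)%SET by rewrite gT inE.
  by move=> /bigcupP[_ /imsetP[s _ ->] si]; exists s.
pose f := [ffun i => sval (gex i)].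
have fP i : i \in g (f i) by rewrite ffunE; case: (gex i).
have fE i s : (f i == s) = (i \in g s).
  (* Blocks sharing the point [i] coincide, and injectivity of [g] identifies their labels. *)
  apply/eqP/idP => [<- //|si]; apply/ginj/eqP/negPn/negP => /gtriv.
  move=> /(_ (imset_f _ _) (imset_f _ _)) /= gd.
  by have /pred0P/(_ i) := gd (finset.in_setT _) (finset.in_setT _); rewrite /= fP si.
exists f; last by apply/ffunP => s; apply/setP => i; rewrite mem_fibers fE.
rewrite inE; apply/eqP/setP => s; rewrite !inE /=.
have /set0Pn[i si] : g s != finset.set0.
  by apply: contraNneq g0 => <-; exact: imset_f.
by apply/codomP; exists i; apply/esym/eqP; rewrite fE.
Qed.

(** By [onto_fibers] surjections are partitions with labelled blocks, and [b] blocks admit [b!]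
    labellings. *)
Lemma card_onto (a b : nat) :
  #|[set f : {ffun 'I_a -> 'I_b} | anchors finset.setT f == finset.setT]%SET| =
  (stirling2 a b * b`!)%N.
Proof.
rewrite -(card_imset _ (@fibers_inj _ _)).
rewrite (eq_card (onto_fibers (I := 'I_a) (S := 'I_b))) -sum1_card.
rewrite (partition_big (fun g : {ffun _} => g @: finset.setT)%SET
  (mem [set P : {set {set 'I_a}} |
      finset.partition P [set: 'I_a] & #|P| == b]%SET)) /= => [|g]; last first.
  move=> /andP[/injectiveP ginj gP]; rewrite inE gP card_imset //.
  by rewrite cardsT card_ord eqxx.
rewrite -sum_nat_const; apply: eq_bigr => P; rewrite inE => /andP[PT /eqP Pb].
have -> : b`! =
    #|[set g : {ffun 'I_b -> {set 'I_a}} in ffun_on (mem P) | injectiveb g]%SET|.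
  by rewrite card_inj_ffuns_on card_ord Pb ffactnn.
rewrite -sum1_card.
apply: eq_bigl => g; rewrite inE unfold_in /=.
apply/andP/andP => [[/andP[ginj _] /eqP <-]|[/ffun_onP gP ginj]].
  by split=> //; apply/ffun_onP => s; exact: imset_f.
(* An injection of [b] labels into the [b] blocks of [P] uses every block. *)
suff gE : (g @: finset.setT)%SET = P by rewrite gE eqxx ginj PT.
apply/eqP; rewrite eqEcard; apply/andP; split.
  by apply/fintype.subsetP => _ /imsetP[s _ ->]; exact: gP.
by rewrite card_imset ?cardsT ?card_ord ?Pb //; exact/injectiveP.
Qed.

(** In [sum_anchors_eq] with unit weights and [K] full, the left side counts surjections and the
    weight outside [K] is the empty sum [0]. *)
Lemma stirling2_fdiff (a b : nat) :
  iter b fdiff (fun x => x ^+ a) 0 = (stirling2 a b * b`!)%N%:Z.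
Proof.
have := @sum_anchors_eq 'I_a 'I_b finset.setT (fun=> 1) (fun _ _ => erefl)
  finset.setT (subxx _).
rewrite [\sum_(s | s \notin _) _]big_pred0 => [|s]; last by rewrite inE.
rewrite cardsT !card_ord => <-.
rewrite [LHS](eq_bigr (fun=> 1)) => [|f _]; last by rewrite big1.
by rewrite sumr_const -card_onto -natz; congr (_ *+ _); apply: eq_card => f; rewrite !inE.
Qed.

Lemma stirling2_small (a b : nat) : (a < b)%N -> stirling2 a b = 0%N.
Proof.
move=> ab; apply/eqP; rewrite cards_eq0; apply/eqP/setP => P; rewrite !inE.
apply/andP => -[/[dup] /card_partition Pa /and3P[_ _ P0] /eqP Pb].
move: ab; rewrite ltnNge => /negP; apply.
rewrite -Pb -[leqRHS]card_ord -cardsT Pa -sum1_card.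
by apply: leq_sum => A AP; rewrite card_gt0; apply: contraNneq P0 => <-.
Qed.

(** Expand [(x + z) ^ n] binomially and take the difference in [z] at [0]. *)
Lemma fdiff_exp (b n : nat) (x : int) : (b <= n)%N ->
  iter b fdiff (fun y => y ^+ n) x =
  b`!%:Z * \sum_(0 <= t < (n - b).+1)
    ('C(n, t) * stirling2 (n - t) b)%N%:Z * x ^+ t.
Proof.
move=> bn; rewrite -[x in LHS]addr0 iter_fdiff_shift.
have -> : (fun z => (x + z) ^+ n) =
    fun z => \sum_(t <- iota 0 n.+1) ('C(n, t)%:Z * x ^+ t) * z ^+ (n - t).
  apply/funext => z; rewrite addrC exprDn -(big_mkord xpredT
    (fun t => z ^+ (n - t) * x ^+ t *+ 'C(n, t))) /index_iota subn0.
  apply: eq_bigr => t _; rewrite -mulr_natl natz; ring.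
rewrite iter_fdiff_sum -[iota 0 n.+1]/(index_iota 0 n.+1).
rewrite (@big_cat_nat _ _ _ (n - b).+1) //=; last by rewrite ltnS leq_subr.
(* For [t > n - b] fewer than [b] objects remain, so the Stirling number vanishes. *)
rewrite [X in _ + X]big_nat [X in _ + X]big1 ?addr0 => [|t /andP[nbt tn]].
  rewrite mulr_sumr; apply: eq_bigr => t _.
  by rewrite stirling2_fdiff !PoszM; ring.
by rewrite stirling2_fdiff stirling2_small ?mul0n ?mulr0 //; lia.
Qed.

(** * The Euler characteristic as a signed count of cells *)

Definition cell_sign (G : multigraph) (s : vertex G + edge G) : int :=
  if s is inr _ then -1 else 1.

Lemma euler_char_Sigma (R : realType) (G : multigraph) (K : {set vertex G})
    (n q : nat) :
  euler_char (@Sigma (realization R G) (vertex_pts R K) n q) =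
  \sum_(c : cell G n | (q <= #|anchors (inl @: K) c|)%N)
    \prod_i cell_sign (c i).
Proof.
set A := Sigma _ _; rewrite /euler_char big_mkord.
transitivity (\sum_(c in cells_of A) (-1) ^+ cell_dim c : int).
  (* Cells are grouped by dimension, which is at most [n], so [inord] is faithful. *)
  rewrite (partition_big (fun c => inord (cell_dim c) : 'I_n.+1) xpredT) //=.
  apply: eq_bigr => d _; rewrite mulrC -natz mulr_natl -sumr_const.
  have dimE (c : cell G n) : (inord (cell_dim c) : 'I_n.+1) = cell_dim c :> nat.
    rewrite inordK // ltnS; apply: leq_trans (max_card _) _.
    by rewrite card_ord.
  apply/esym/eq_big => [c|c /andP[_ /eqP <-]]; last by rewrite dimE.
  by rewrite -val_eqE /= dimE [in RHS]inE.
apply: eq_big => [c|c _].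
  have -> : anchors (inl @: K) c = inl @: [set v in K | inl v \in codom c]%SET.
    apply/setP => s; apply/idP/imsetP.
      by rewrite inE => /andP[/imsetP[v vK ->] vc]; exists v; rewrite // inE vK.
    by move=> [v + ->]; rewrite !inE => /andP[vK ->]; rewrite imset_f.
  rewrite inE card_imset; last by move=> u v [].
  by apply/asboolP/idP => /open_cell_Sigma.
rewrite (bigID [pred i | if c i is inr _ then true else false]) /=.
rewrite [X in _ * X]big1 ?mulr1 => [|i]; last by case: (c i).
rewrite (eq_bigr (fun=> -1)) => [|i]; last by case: (c i).
by rewrite prodr_const /cell_dim; congr (_ ^+ _); apply: eq_card => i; rewrite !inE.
Qed.

(** This weight outside [K] is [- k - eps], the base point of the differences. *)
Lemma sum_cell_sign (G : multigraph) (K : {set vertex G}) :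
  \sum_(s | s \notin inl @: K) @cell_sign G s =
  #|vertex G|%:Z - #|K|%:Z - #|edge G|%:Z.
Proof.
have inlE v : (inl v \in (inl @: K : {set vertex G + edge G})) = (v \in K).
  by rewrite mem_imset // => u w [].
rewrite big_sumType /=; congr (_ + _).
  under eq_bigl do rewrite inlE.
  rewrite sumr_const natz; apply/eqP; rewrite eq_sym subr_eq -PoszD addnC.
  by apply/eqP; rewrite -(cardC K) addnC.
rewrite (eq_bigl xpredT) => [|e]; last by apply/imsetP => -[].
by rewrite sumr_const mulNrn natz.
Qed.

Theorem theorem2p1 (R : realType) (G : multigraph)
    (Gconn : connected_graph G) (Gnt : ~ is_tree G)
    (K : {set vertex G}) (K0 : K != finset.set0)
    (q : nat) (q0 : (0 < q)%N) (qK : (q <= #|K|)%N)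
    (n : nat) (qn : (q <= n)%N) :
  let k := #|K| in
  let eps : int := #|edge G|%:Z - #|vertex G|%:Z in
  (-1) ^+ (n - q) / (q`!)%:R *
    (euler_char (@Sigma (realization R G) (vertex_pts R K) n q))%:~R
  = \sum_(l <- int_range eps (eps + k%:Z - q%:Z))
      \sum_(0 <= t < (n - q).+1)
        ('C(absz (l - eps + q%:Z - 1)%R, q - 1) * 'C(n, t)
           * stirling2 (n - t) q)%N%:R * l%:~R ^+ t :> rat.
Proof.
move=> k eps; rewrite euler_char_Sigma sum_anchors_geq; last first.
  by move=> _ /imsetP[v _ ->].
rewrite card_imset; last by move=> u v [].
rewrite -/k card_ord sum_cell_sign.
(* From here [q] and [k] denote the predecessors of the original values, as in
   [truncated_newton]. *)
case: q q0 qK qn => // q _; rewrite -/k; case: k => // k qk qn.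
rewrite truncated_newton //.
have -> : int_range eps (eps + k.+1%:Z - q.+1%:Z) =
    [seq eps + i%:Z | i <- index_iota 0 (k - q).+1].
  rewrite /int_range ifT; last by lia.
  by congr [seq _ | i <- iota 0 _.+1]; lia.
rewrite big_map rmorph_sum mulr_sumr; apply: eq_bigr => i _.
set x := eps + i%:Z.
(* The [i]-th evaluation point is the mirror image of [x], the value of [lambda] in the [i]-th
   summand; the parity of the [n]-th power then gives the sign [(-1) ^ n]. *)
have -> : #|vertex G|%:Z - k.+1%:Z - #|edge G|%:Z + (k - q)%N%:Z - i%:Z =
    - x - q.+1%:Z by rewrite /x /eps; lia.
rewrite (@iter_fdiff_reflect _ ((-1) ^+ n)); last by move=> y; exact: exprNn.
rewrite fdiff_exp //.
have -> : `|(x - eps + q.+1%:Z - 1)%R|%N = (i + q)%N by rewrite /x; lia.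
rewrite subn1 /= !rmorphM /= !rmorphXn /= rmorphN1 rmorph_sum /= -!pmulrn.
set c := 'C(i + q, q)%:R; set S := \sum_(_ <= _ < _) _.
(* The prefactor, the reflection of [q.+1] differences and the parity of the power contribute signs
   that cancel. *)
have sgn : (-1) ^+ (n - q.+1) * (-1) ^+ q.+1 * (-1) ^+ n = 1 :> rat.
  by rewrite -exprD subnK // -expr2 sqrr_sign.
have q1 : (q.+1)`!%:R != 0 :> rat by rewrite pnatr_eq0 -lt0n fact_gt0.
transitivity (c * S).
  rewrite -[RHS]mul1r -[X in _ = X * _]sgn; field.
  exact: q1.
rewrite mulr_sumr; apply: eq_bigr => t _.
by rewrite rmorphM rmorphXn /= -pmulrn mulrA -natrM mulnA.
Qed.
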